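(* Let $\varphi$ be a convex $\varphi$-function and let $\sigma$ be a sigmoidal function such that $\phi_\sigma$ has compact support contained in $[-\Upsilon,\Upsilon]$, with $\Upsilon>0$. Then, for every $f\in W^{1,\varphi}(I)$, there exists $\lambda>0$ such that $$I^\varphi\big[\lambda(K_nf-f)\big]\le I^\varphi\left[\frac{2\lambda(1+\Upsilon)}{n}\,f'\right]$$ for every $n\in\mathbb N$.
   Context: Let $I=[a,b]\subset\mathbb R$ with $a<b$. Sigmoidal functions. A measurable $\sigma:\mathbb R\to\mathbb R$ is sigmoidal if $\lim_{x\to-\infty}\sigma(x)=0$ and $\lim_{x\to+\infty}\sigma(x)=1$. Here every sigmoidal function is assumed non-decreasing, with $\sigma(1)<1$, and to satisfy: (S1) $\sigma(x)-1/2$ is an odd function; (S2) $\sigma\in C^2(\mathbb R)$ is concave for $x\ge 0$; (S3) $\sigma(x)=\mathcal O(|x|^{-\alpha-1})$ as $x\to-\infty$ for some $\alpha>0$. The density function is $\phi_\sigma(x):=\frac12[\sigma(x+1)-\sigma(x-1)]$, $x\in\mathbb R$. Operators. For $f:I\to\mathbb R$ locally integrable and $n\in\mathbb N$ with $\lceil na\rceil\le\lfloor nb\rfloor-1$ (this is assumed of every $n$ considered), $$(K_nf)(x)=\frac{\sum_{k=\lceil na\rceil}^{\lfloor nb\rfloor-1}\left[n\int_{k/n}^{(k+1)/n}f(u)\,du\right]\phi_\sigma(nx-k)}{\sum_{k=\lceil na\rceil}^{\lfloor nb\rfloor-1}\phi_\sigma(nx-k)},\quad x\in I.$$ Orlicz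 spaces. A $\varphi$-function is a continuous non-decreasing $\varphi:[0,\infty)\to[0,\infty)$ with $\varphi(0)=0$, $\varphi(u)>0$ for $u>0$, $\lim_{u\to\infty}\varphi(u)=+\infty$. For measurable $f$ on $I$, $I^\varphi[f]:=\int_I\varphi(|f(x)|)\,dx$; $L^\varphi(I)$ is the set of measurable $f$ on $I$ with $I^\varphi[\lambda f]<+\infty$ for some $\lambda>0$. The Sobolev-Orlicz space is $W^{1,\varphi}(I):=\{f\in AC(I): f'\in L^\varphi(I)\}$, where $AC(I)$ is the space of absolutely continuous functions $I\to\mathbb R$. *)

(* Defs.v *)
From HB Require Import structures.
From mathcomp Require Import all_boot all_order all_algebra.
From mathcomp Require Import all_classical all_reals all_analysis.

Set Implicit Arguments.
Unset Strict Implicit.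
Unset Printing Implicit Defensive.

Import Order.TTheory GRing.Theory Num.Theory.
Import numFieldNormedType.Exports.

Local Open Scope classical_set_scope.
Local Open Scope ring_scope.

(* Functions on I = [a, b] are represented by total functions R -> R of which
   only the values on [a, b] matter. *)

Section sigmoidal_functions.
Context {R : realType}.

Definition C2 (s : R -> R) : Prop :=
  [/\ forall x, derivable s x 1,
      forall x, derivable (derive1 s) x 1 &
      continuous (derive1 (derive1 s))].

(* Includes the standing assumptions made on all sigmoidal functions:
   monotonicity, s 1 < 1, symmetry, C^2 and concavity, decay at -oo. *)
Record sigmoidal (s : R -> R) : Prop := Sigmoidal {
  sigmoidal_measurable : measurable_fun setT s;
  sigmoidal_ninfty : s x @[x --> -oo] --> (0 : R);
  sigmoidal_pinfty : s x @[x --> +oo] --> (1 : R);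
  sigmoidal_nondecreasing : {homo s : x y / x <= y};
  sigmoidal_lt1 : s 1 < 1;
  sigmoidal_odd : forall x, s (- x) - 2^-1 = - (s x - 2^-1);
  sigmoidal_C2 : C2 s;
  sigmoidal_concave : convex_function (`[0, +oo[ : set R^o) (fun x => - s x);
  sigmoidal_decay : exists2 alpha : R, 0 < alpha &
    exists C : R, \forall x \near -oo, `|s x| <= C * `|x| `^ (- alpha - 1)
}.

Definition density (s : R -> R) (x : R) : R := 2^-1 * (s (x + 1) - s (x - 1)).

Definition supp (g : R -> R) : set R := closure [set x | g x != 0].

End sigmoidal_functions.

Definition int_range (p q : int) : seq int :=
  if (p <= q)%R then [seq p + j%:Z | j <- iota 0 (absz (q - p + 1))] else [::].

Lemma mem_int_range p q k : (k \in int_range p q) = (p <= k <= q).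
Proof.
rewrite /int_range; case: ifPn => pq; last first.
  by apply/esym/negbTE/negP => /andP[pk /(le_trans pk)]; rewrite (negbTE pq).
have sizeE : (absz (q - p + 1))%:Z = q - p + 1.
  by rewrite gez0_abs// addr_ge0// subr_ge0.
apply/mapP/andP => [[j] | [pk kq]].
  rewrite mem_iota /= add0n -ltz_nat sizeE => jlt ->; split.
    by rewrite lerDl.
  by move: jlt; rewrite ltzD1 lerBrDl.
have kE : (absz (k - p))%:Z = k - p by rewrite gez0_abs// subr_ge0.
exists (absz (k - p)); last by rewrite kE addrC subrK.
by rewrite mem_iota /= add0n -ltz_nat sizeE kE ltzD1 lerD2r.
Qed.

Lemma int_range_uniq p q : uniq (int_range p q).
Proof.
rewrite /int_range; case: ifP => // _.
by rewrite map_inj_uniq ?iota_uniq// => i j /addrI[].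
Qed.

Section kantorovich_orlicz.
Context {R : realType}.
Local Notation mu := (@lebesgue_measure R).

Definition Kantorovich (a b : R) (s f : R -> R) (n : nat) (x : R) : R :=
  let r := int_range (Num.ceil (n%:R * a)) (Num.floor (n%:R * b) - 1) in
  (\sum_(k <- r)
     n%:R * (\int[mu]_(u in `[k%:~R / n%:R, (k + 1)%:~R / n%:R]) f u)
     * density s (n%:R * x - k%:~R))
  / (\sum_(k <- r) density s (n%:R * x - k%:~R)).

(* Only the values of phi on [0, +oo[ are constrained, and used. *)
Record phi_function (phi : R -> R) : Prop := PhiFunction {
  phi_continuous : {within `[0, +oo[, continuous phi};
  phi_nondecreasing : {in `[0, +oo[ &, {homo phi : x y / x <= y}};
  phi0 : phi 0 = 0;
  phi_gt0 : forall u, 0 < u -> 0 < phi u;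
  phi_pinfty : phi u @[u --> +oo] --> +oo
}.

Definition convex_phi_function (phi : R -> R) : Prop :=
  phi_function phi /\ convex_function (`[0, +oo[ : set R^o) phi.

Definition modular (phi : R -> R) (a b : R) (g : R -> R) : \bar R :=
  (\int[mu]_(x in `[a, b]) (phi `|g x|)%:E)%E.

Definition Orlicz (phi : R -> R) (a b : R) : set (R -> R) :=
  [set g | measurable_fun `[a, b] g /\
     exists2 lambda : R, 0 < lambda &
       (modular phi a b (fun x => lambda * g x)%R < +oo)%E].

Definition abs_cont (a b : R) : set (R -> R) :=
  [set f | forall e : R, 0 < e -> exists2 d : R, 0 < d &
     forall (m : nat) (u v : 'I_m -> R),
       (forall i, [/\ a <= u i, u i < v i & v i <= b]) ->
       trivIset setT (fun i => `]u i, v i[%classic) ->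
       \sum_(i < m) (v i - u i) < d ->
       \sum_(i < m) `|f (v i) - f (u i)| < e].

(* An absolutely continuous f is derivable at almost every point of [a, b];
   [derive1 f] is its derivative there, and its values on the remaining null
   set (including possibly a and b) do not affect modulars.  On ]a, b[,
   [derive1 f] is automatically Borel measurable, so that it makes no
   difference whether measurability in [Orlicz] is Borel or Lebesgue. *)
Definition Sobolev_Orlicz (phi : R -> R) (a b : R) : set (R -> R) :=
  [set f | abs_cont a b f /\ Orlicz phi a b (derive1 f)].

End kantorovich_orlicz.

(* Main.v *)
Require Import Defs.
From HB Require Import structures.
From mathcomp Require Import all_boot all_order all_algebra.
From mathcomp Require Import all_classical all_reals all_analysis.
From mathcomp Require Import measurable_realfun ring lra.

Set Implicit Arguments.
Unset Strict Implicit.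
Unset Printing Implicit Defensive.

Import Order.TTheory GRing.Theory Num.Theory.
Import numFieldNormedType.Exports.

Local Open Scope classical_set_scope.
Local Open Scope ring_scope.

(** The estimate holds with lambda = 1; write h = (1 + Upsilon) / n.

    Pointwise part.  K_n f x is a weighted mean of averages of f over cells
    [k/n, (k+1)/n] contained in I, and only the k with |n x - k| <= Upsilon
    carry weight, so that all the points involved are within h of x.  The
    weights do not vanish simultaneously: some admissible k has
    |n x - k| <= 2, and the density is positive on [-2, 2] because a concave
    sigma with sigma 1 < 1 cannot be constant on an interval starting in
    [0, 1] and still tend to 1.  Hence (lemma Kantorovich_error_le) the error
    at x is at most the oscillation of f within h of x, and therefore at most
    the integral of |f'|, extended by 0 outside I, over [x - h, x + h].

    Averaging part.  The window has length 2 h, so Jensen's inequality bounds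
    phi of the error by the mean over the window of phi (2 h |f'|)
    (jensen_window).  Integrating in x and exchanging the integrals with
    Tonelli's theorem gives each t the total weight 1
    (integral_moving_window), which leaves the modular of 2 h f'.

    The bound of the increments of f by integrals of |f'|
    (abs_cont_increment_le) is the fundamental theorem of calculus for
    absolutely continuous functions.  The total variation V of f is again
    absolutely continuous, so f is the difference of two nondecreasing
    absolutely continuous functions, V and V - f.  The Lebesgue-Stieltjes
    measure of such a function vanishes on Lebesgue null sets: a null set is
    covered by an open set of small measure, whose components form a disjoint
    family of intervals of small total length.  The Radon-Nikodym theorem then
    provides a density, and Lebesgue's differentiation theorem identifies it
    with f' almost everywhere. *)

(** * Absolute continuity through finite families of intervals *)

Section global_absolute_continuity.
Context {R : realType}.
Implicit Types (a b : R) (f G : R -> R).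

Definition clamp a b x : R := Num.max a (Num.min b x).

Lemma clamp_bound a b x : a <= b -> a <= clamp a b x <= b.
Proof.
move=> ab; rewrite /clamp le_max lexx/= ge_max ab/= ge_min lexx//.
Qed.

Lemma clampE a b x : a <= x <= b -> clamp a b x = x.
Proof.
by move=> /andP[ax xb]; rewrite /clamp min_r// max_r.
Qed.

Lemma clamp_homo a b : {homo clamp a b : x y / x <= y}.
Proof.
by move=> x y xy; rewrite /clamp /Num.max /Num.min; do ! case: ifP; lra.
Qed.

Lemma clamp_lip a b x y : x <= y -> clamp a b y - clamp a b x <= y - x.
Proof.
by move=> xy; rewrite /clamp /Num.max /Num.min; do ! case: ifP; lra.
Qed.

Lemma clamp_sub a b u v : `]clamp a b u, clamp a b v[ `<=` `]u, v[.
Proof.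
move=> x; rewrite /= !in_itv/= /clamp.
by rewrite /Num.max /Num.min; do ! case: ifP; lra.
Qed.

(** The families are indexed by arbitrary finite types, and not by ordinals as
    in [abs_cont], so that subdividing each interval of a family yields a
    family indexed by a dependent sum. *)
Definition small_increments G (e d : R) :=
  forall (I : finType) (u v : I -> R), (forall i, u i <= v i) ->
    trivIset setT (fun i => `]u i, v i[%classic) ->
    \sum_i (v i - u i) < d -> \sum_i `|G (v i) - G (u i)| < e.

(** Absolute continuity on the whole line, with empty intervals allowed; the
    functions it serves for are extended by constants outside [a, b], which
    removes all side conditions on the location of the intervals. *)
Definition global_ac G :=
  forall e : R, 0 < e -> exists2 d : R, 0 < d & small_increments G e d.

(** Clamping shrinks the intervals of a family and keeps them disjoint; those
    that become empty contribute nothing to the increments and are dropped. *)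
Lemma abs_cont_clamp a b f : a < b -> abs_cont a b f ->
  global_ac (f \o clamp a b).
Proof.
move=> ab acf e e0; have [d d0 H] := acf e e0; exists d => //.
move=> I u v uv tr sd.
pose u' i := clamp a b (u i); pose v' i := clamp a b (v i).
pose P := [pred i | u' i < v' i].
have u'v' i : u' i <= v' i by exact: clamp_homo.
have sub i : `]u' i, v' i[ `<=` `]u i, v i[.
  exact: clamp_sub.
rewrite (bigID P)/= [X in _ + X]big1 ?addr0; last first.
  move=> i; rewrite -leNgt => vu.
  suff -> : clamp a b (v i) = clamp a b (u i) by rewrite subrr normr0.
  by apply/eqP; rewrite eq_le vu u'v'.
rewrite (eq_bigl (mem P))// big_enum_val/=.
apply: (H _ (fun j : 'I_#|P| => u' (enum_val j)) (fun j => v' (enum_val j))).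
- move=> j; split.
  + by have /andP[] := clamp_bound (u (enum_val j)) (ltW ab).
  + by have := enum_valP j.
  + by have /andP[] := clamp_bound (v (enum_val j)) (ltW ab).
- apply/trivIsetP => i j _ _ ij.
  have /trivIsetP/(_ (enum_val i) (enum_val j) Logic.I Logic.I) := tr.
  move=> /(_ _)/eqP; rewrite (inj_eq enum_val_inj) => /(_ ij).
  apply: contraPP => /eqP /set0P[x [/sub xi /sub xj]] /eqP/seteqP[+ _].
  by apply; split; eassumption.
- apply: le_lt_trans sd.
  rewrite -(big_enum_val (fun i => v' i - u' i))/=.
  rewrite [leRHS](bigID P)/= -[leLHS]addr0 lerD//.
    by apply: ler_sum => i _; exact: clamp_lip.
  by apply: sumr_ge0 => i _; rewrite subr_ge0.
Qed.

Lemma itv_partition_trivIset (u v : R) s : itv_partition u v s ->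
  trivIset setT (fun j : 'I_(size s) =>
    `]nth v (u :: s) j, nth v (u :: s) j.+1[%classic).
Proof.
move=> [us _]; apply/trivIsetP => i j _ _.
wlog ij : i j / (i < j)%N.
  move=> w; have [ij|ji|/val_inj ->] := ltngtP i j; last by rewrite eqxx.
    exact: w.
  by rewrite eq_sym setIC; exact: w.
move=> _; apply/seteqP; split => // x [/=]; rewrite !in_itv/=.
move=> /andP[_ xi] /andP[jx _].
have : nth v s i <= nth v (u :: s) j.
  have srt : sorted <=%O (u :: s).
    by apply: (@sub_path _ _ _ _ _ _ us) => ? ? /ltW.
  have := @sorted_leq_nth _ <=%O le_trans le_refl v (u :: s) srt i.+1 j.
  by move=> /(_ _ _ ij); apply; rewrite inE/= ltnS// ltnW.
by have := lt_trans jx xi; rewrite ltNge => /negbTE ->.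
Qed.

Lemma itv_partition_sum (u v : R) s : itv_partition u v s ->
  \sum_(j < size s) (nth v (u :: s) j.+1 - nth v (u :: s) j) = v - u.
Proof.
move=> uvs.
rewrite -(big_mkord xpredT (fun j => nth v (u :: s) j.+1 - nth v (u :: s) j)).
by rewrite telescope_sumr// (itv_partition_nth_size _ uvs).
Qed.

(** Replacing every interval of a disjoint family by the cells of a partition
    of it gives a disjoint family of the same total length. *)
Lemma small_increments_partition G e d : small_increments G e d ->
  forall (I : finType) (u v : I -> R) (s : I -> seq R),
    (forall i, itv_partition (u i) (v i) (s i)) ->
    trivIset setT (fun i => `]u i, v i[%classic) ->
    \sum_i (v i - u i) < d -> \sum_i variation (u i) (v i) G (s i) < e.
Proof.
move=> H I u v s uvs tr sd.
under eq_bigr do rewrite /variation big_mkord.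
rewrite sig_big_dep/=.
pose L (p : {i : I & 'I_(size (s i))}) :=
  nth (v (tag p)) (u (tag p) :: s (tag p)) (tagged p).
pose U (p : {i : I & 'I_(size (s i))}) :=
  nth (v (tag p)) (u (tag p) :: s (tag p)) (tagged p).+1.
apply: (H _ L U).
- move=> [i j]; rewrite /L /U/=; apply/ltW.
  by have [/(pathP (v i)) lt _] := uvs i; exact: lt (ltn_ord j).
- apply/trivIsetP => -[i j] [i' j'] _ _ /eqP neq.
  have [ii'|ii'] := eqVneq i i'.
    subst i'; have /trivIsetP := itv_partition_trivIset (uvs i).
    move=> /(_ j j' Logic.I Logic.I); apply.
    by apply/eqP => jj'; apply: neq; rewrite jj'.
  have /trivIsetP/(_ i i' Logic.I Logic.I ii') := tr.
  have sub k (l : 'I_(size (s k))) :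
      `]L (Tagged _ l), U (Tagged _ l)[ `<=` `]u k, v k[.
    rewrite /L /U/=; move=> x; rewrite /= !in_itv/= => /andP[xl xr].
    rewrite (le_lt_trans _ xl)/=; last first.
      by apply: itv_partition_nth_ge (uvs k); rewrite ltnS ltnW.
    rewrite (lt_le_trans xr)//.
    by apply: (@itv_partition_nth_le _ _ (u k) _ (s k) l.+1) (uvs k); rewrite ltnS.
  move=> /seteqP[Hs _]; apply/seteqP; split => // x [xi xi'].
  by apply: (Hs x); split; [exact: sub xi|exact: sub xi'].
- apply: le_lt_trans sd.
  rewrite -(sig_big_dep xpredT (fun=> xpredT)
    (fun i (j : 'I_(size (s i))) =>
      nth (v i) (u i :: s i) j.+1 - nth (v i) (u i :: s i) j))/=.
  by apply: ler_sum => i _; rewrite itv_partition_sum.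
Qed.

(** The total variation of [G] on each interval of the family is nearly attained
    on a partition, so the bound on the increments over all partitions passes
    to the sum of the total variations. *)
Lemma global_ac_small_variation G : global_ac G ->
  forall e : R, 0 < e -> exists2 d : R, 0 < d &
  forall (I : finType) (u v : I -> R), (forall i, u i <= v i) ->
    trivIset setT (fun i => `]u i, v i[%classic) ->
    \sum_i (v i - u i) < d ->
    (forall i, total_variation (u i) (v i) G \is a fin_num) /\
    \sum_i fine (total_variation (u i) (v i) G) <= e.
Proof.
move=> acG e e0; have [d d0 H] := acG e e0; exists d => // I u v uv tr sd.
have HP := small_increments_partition H.
have fin i : total_variation (u i) (v i) G \is a fin_num.
  rewrite ge0_fin_numE ?total_variation_ge0//.
  apply: (@le_lt_trans _ _ e%:E); last exact: ltry.
  apply: ge_ereal_sup => _ [_ [l lp <-] <-]; rewrite lee_fin.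
  have := HP 'I_1 (fun=> u i) (fun=> v i) (fun=> l) (fun=> lp).
  rewrite !big_ord1 => vare; apply/ltW/vare.
    by apply/trivIsetP => i1 i2 _ _; rewrite (ord1 i1) (ord1 i2) eqxx.
  apply: le_lt_trans sd.
  by rewrite (bigD1 i)//= lerDl sumr_ge0// => j _; rewrite subr_ge0.
split => //; apply/ler_addgt0Pr => eta eta0.
(* each of the #|I| suprema is approached up to h, for a total loss below eta *)
pose h := eta / (#|I|.+1)%:R.
have h0 : 0 < h by rewrite divr_gt0// ltr0n.
have /choice[s Hs] : forall i, exists l, itv_partition (u i) (v i) l /\
    fine (total_variation (u i) (v i) G) - h <= variation (u i) (v i) G l.
  move=> i; have [_ [_ [l lp <-] <-]] := ub_ereal_sup_adherent h0 (fin i).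
  rewrite -/(total_variation (u i) (v i) G) => lth; exists l; split => //.
  by apply/ltW; rewrite -lte_fin EFinB fineK.
have lt := HP _ _ _ s (fun i => (Hs i).1) tr sd.
apply: (@le_trans _ _ (\sum_i (variation (u i) (v i) G (s i) + h))).
  by apply: ler_sum => i _; have [_] := Hs i; rewrite lerBlDr.
rewrite big_split/= lerD ?(ltW lt)// sumr_const -mulr_natr /h -mulrA.
rewrite ler_piMr ?(ltW eta0)// mulrC ler_pdivrMr ?ltr0n// mul1r ler_nat.
exact: leqW.
Qed.

End global_absolute_continuity.

(** * Decomposition into monotone absolutely continuous functions *)

Section variation_decomposition.
Context {R : realType}.
Implicit Types (a b : R) (f G : R -> R).

Lemma global_ac_continuous G : global_ac G -> continuous G.
Proof.
move=> acG x; apply/cvgrPdist_lt => e e0; have [d d0 H] := acG e e0.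
have H1 (u v : R) : u <= v -> v - u < d -> `|G v - G u| < e.
  move=> uv vud; have := H 'I_1 (fun=> u) (fun=> v) (fun=> uv).
  rewrite !big_ord1; apply => //.
  by apply/trivIsetP => i1 i2 _ _; rewrite (ord1 i1) (ord1 i2) eqxx.
near=> y.
have : `|x - y| < d by near: y; exact: cvgr_dist_lt.
have [yx|xy] := leP y x.
  by rewrite ger0_norm ?subr_ge0//; exact: H1.
rewrite ler0_norm ?subr_le0 ?(ltW xy)// opprB [X in _ -> X < _]distrC.
exact: H1 (ltW xy).
Unshelve. all: by end_near. Qed.

(** An interval is covered by finitely many pieces on each of which the
    variation is at most 1. *)
Lemma global_ac_fin_variation G u v : global_ac G -> u <= v ->
  total_variation u v G \is a fin_num.
Proof.
move=> acG uv; have [d d0 H] := global_ac_small_variation acG ltr01.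
have small x y : x <= y -> y - x < d -> total_variation x y G \is a fin_num.
  move=> xy yxd; have [] := H 'I_1 (fun=> x) (fun=> y) (fun=> xy).
  - by apply/trivIsetP => i1 i2 _ _; rewrite (ord1 i1) (ord1 i2) eqxx.
  - by rewrite big_ord1.
  - by move=> /(_ ord0).
have step n y : u <= y -> y - u < n%:R * (d / 2) ->
    total_variation u y G \is a fin_num.
  elim: n y => [|n ih] y uy; first by rewrite mul0r ltNge subr_ge0 uy.
  rewrite -natr1 => yu.
  have [uyd|uyd] := ltP (y - u) d; first exact: small.
  have uz : u <= y - d / 2 by lra.
  have zy : y - d / 2 <= y by lra.
  have zyd : y - (y - d / 2) < d by lra.
  rewrite (total_variationD _ uz zy) fin_numD (small _ _ zy zyd) andbT.
  by apply: ih => //; lra.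
pose n := Num.bound ((v - u) / (d / 2)).
apply: (step n) => //; rewrite -ltr_pdivrMr ?divr_gt0//.
by rewrite /n archi_boundP// !divr_ge0 ?subr_ge0// ltW.
Qed.

(** [V] is the total variation of [f] from [a], and [W] is [V - f]: an increment
    of [f] is bounded by the corresponding increment of [V], so [W] is
    nondecreasing. *)
Lemma abs_cont_decomposition a b f : a < b -> abs_cont a b f ->
  exists V W : R -> R,
  [/\ [/\ nondecreasing V, global_ac V & forall x, V x = V (clamp a b x)],
      [/\ nondecreasing W, global_ac W & forall x, W x = W (clamp a b x)] &
      forall x, f (clamp a b x) = V x - W x].
Proof.
move=> ab acf; have acG := abs_cont_clamp ab acf; set G := f \o clamp a b in acG.
have cc x : clamp a b (clamp a b x) = clamp a b x.
  exact/clampE/clamp_bound/ltW.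
have ac x : a <= clamp a b x by have /andP[] := clamp_bound x (ltW ab).
pose V x := fine (total_variation a (clamp a b x) G).
have VB x y : x <= y ->
    V y - V x = fine (total_variation (clamp a b x) (clamp a b y) G).
  move=> xy; have cxy := clamp_homo a b xy.
  rewrite /V (total_variationD _ (ac x) cxy) fineD ?global_ac_fin_variation//.
  by rewrite addrAC subrr add0r.
have ndV : nondecreasing V.
  move=> x y xy; rewrite -subr_ge0 VB// fine_ge0// total_variation_ge0//.
  exact: clamp_homo.
have GV x y : x <= y -> `|G y - G x| <= V y - V x.
  move=> xy; have cxy := clamp_homo a b xy.
  rewrite VB// -lee_fin fineK ?global_ac_fin_variation//.
  by have := total_variation_ge G cxy; rewrite /G/= !cc.
have acV : global_ac V.
  move=> e e0; have e20 : 0 < e / 2 by rewrite divr_gt0.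
  have [d d0 H] := global_ac_small_variation acG e20.
  exists d => // I u v uv tr sd.
  have cuv i := clamp_homo a b (uv i).
  have [] := H I (clamp a b \o u) (clamp a b \o v) cuv.
  - move: tr => /trivIsetP tr; apply/trivIsetP => i j _ _ ij.
    have /seteqP[tij _] := tr i j Logic.I Logic.I ij.
    apply/seteqP; split => // x [/clamp_sub ? /clamp_sub ?].
    by apply: (tij x); split.
  - by apply: le_lt_trans sd; apply: ler_sum => i _; exact: clamp_lip.
  move=> _ sV; apply: (@le_lt_trans _ _ (e / 2)); last by lra.
  apply: le_trans sV; apply: ler_sum => i _.
  by rewrite ger0_norm ?subr_ge0 ?ndV// VB.
exists V, (fun x => V x - G x); split.
- by split => // x; rewrite /V cc.
- split => [x y xy||x].
  + by have := ler_normlW (GV _ _ xy); lra.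
  + move=> e e0; have e20 : 0 < e / 2 by rewrite divr_gt0.
    have [d d0 H] := acV _ e20; have [d' d'0 H'] := acG _ e20.
    exists (Num.min d d'); first by rewrite lt_min d0.
    move=> I u v uv tr.
    rewrite lt_min => /andP[/(H _ _ _ uv tr) h /(H' _ _ _ uv tr) h'].
    apply: (@le_lt_trans _ _
        (\sum_i (`|V (v i) - V (u i)| + `|G (v i) - G (u i)|))).
      apply: ler_sum => i _; rewrite (le_trans _ (ler_normB _ _))//.
      rewrite [leLHS](_ : _ = `|V (v i) - V (u i) - (G (v i) - G (u i))|)//.
      by congr `|_|; ring.
    by rewrite big_split/=; lra.
  + by rewrite /V /G/= !cc.
- by move=> x; rewrite /G/=; ring.
Qed.

End variation_decomposition.

(** * Densities of absolutely continuous Stieltjes measures *)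

Section absolutely_continuous_stieltjes_measure.
Context {R : realType}.
Local Notation mu := (@lebesgue_measure R).
Local Open Scope ereal_scope.

(** Finiteness of the measure excludes the unbounded intervals. *)
Lemma open_interval_finite_measure (I : set R) : open I -> is_interval I ->
  mu I < +oo -> exists u v : R, (u <= v)%R /\ I = `]u, v[%classic.
Proof.
move=> oI iI muI; have [->|I0] := eqVneq I set0.
  by exists 0%R, 0%R; split => //; rewrite set_itvoo0.
have IE := (is_intervalP I).1 iI.
move: muI; have : (I°)%classic = I by exact/interior_id.
move: I0; rewrite IE -/[set` Rhull I].
case: (Rhull I) => -[ba x|[]] [bb y|[]] I0; rewrite ?interior_itv.
- move=> <- _; exists x, y; split => //.
  rewrite leNgt; apply: contra I0 => yx; apply/eqP.
  by apply: set_itv_ge; case: ba; case: bb; rewrite bnd_simp -?leNgt -?ltNge ?ltW.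
- by rewrite set_itv_ge ?eqxx in I0 => //; rewrite -leNgt.
- by move=> _; rewrite lebesgue_measure_itv/= ltry.
- by move=> _; rewrite lebesgue_measure_itv/= ltNyr.
- by rewrite set_itv_ge ?eqxx in I0 => //; rewrite -leNgt.
- by move=> _; rewrite lebesgue_measure_itv/=.
- by rewrite set_itv_ge ?eqxx in I0 => //; rewrite -leNgt; case: bb I0.
- by rewrite set_itv_ge ?eqxx in I0 => //; rewrite -leNgt.
- by rewrite set_itv_ge ?eqxx in I0 => //; rewrite -leNgt.
Qed.

Lemma stieltjes_itvoc (g : cumulative R R) (x y : R) : (x <= y)%R ->
  lebesgue_stieltjes_measure g `]x, y]%classic = (g y - g x)%:E.
Proof.
move=> xy; rewrite /lebesgue_stieltjes_measure/= /measure_extension/=.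
by rewrite measurable_mu_extE/= ?wlength_itv_bnd//; exact: is_ocitv.
Qed.

(** A null set lies in an open set of Lebesgue measure less than [d].  Its
    components are disjoint intervals of total length less than [d], so the
    increments of [g] over finitely many of them sum to less than [e]; in the
    limit the Stieltjes measure of the open set is at most [e]. *)
Lemma stieltjes_dominated (g : cumulative R R) : global_ac g ->
  lebesgue_stieltjes_measure g `<< mu.
Proof.
move=> acg; pose nu : {measure set (measurableTypeR R) -> \bar R} :=
  lebesgue_stieltjes_measure g.
apply/null_content_dominatesP => A mA muA0.
apply/eqP; rewrite eq_le measure_ge0 andbT; apply/lee_addgt0Pr => e e0.
rewrite add0e; have [d d0 H] := acg e e0.
have lem (m : {measure set (measurableTypeR R) -> \bar R}) (B D : set R) :
    measurable B -> measurable D -> B `<=` D -> m B <= m D.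
  by move=> mB mD BD; apply: le_measure; rewrite ?inE.
have muAoo : mu A < +oo by rewrite muA0.
have [U [oU AU UAd]] := lebesgue_regularity_outer mA muAoo d0.
have mU : measurable U by exact: open_measurable.
have muU : mu U < d%:E.
  rewrite -(setDUK AU) (le_lt_trans (measureU2 _ _ _))//; first exact: measurableD.
  by rewrite [X in X + _ < _](_ : _ = 0)// add0e.
pose I := open_disjoint_itv oU.
have UE : U = \bigcup_q I q := open_disjoint_itv_bigcup oU.
have IU q : I q `<=` U by rewrite [X in _ `<=` X]UE; exact: bigcup_sup.
have tI : trivIset setT I := open_disjoint_itv_trivIset (oU:=oU).
have mI q : measurable (I q) by apply: open_measurable; exact: open_disjoint_itv_open.
have /choice[u /choice[v uvI]] :
    forall q, exists u v : R, (u <= v)%R /\ I q = `]u, v[%classic.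
  move=> q; apply: open_interval_finite_measure.
  - exact: open_disjoint_itv_open.
  - exact: open_disjoint_itv_is_interval.
  - apply: le_lt_trans (lt_trans muU (ltry _)).
    exact: lem (mI q) mU (IU q).
apply: (@le_trans _ _ (nu U)); first exact: lem.
have mUI (m : {measure set (measurableTypeR R) -> \bar R}) :
    m U = \sum_(q <oo) m (I q).
  rewrite [in LHS]UE; apply: measure_semi_bigcup => //.
  by rewrite -UE.
rewrite mUI.
apply: lime_le; first exact: is_cvg_nneseries.
near=> N; rewrite big_mkord.
apply: (@le_trans _ _ (\sum_(q < N) (`|g (v q) - g (u q)|%R)%:E)).
  apply: lee_sum => q _; have [uv ->] := uvI q.
  rewrite ger0_norm ?subr_ge0 ?cumulative_is_nondecreasing// -stieltjes_itvoc//.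
  by apply: lem; [exact: measurable_itv|exact: measurable_itv|exact: subset_itv_oo_oc].
rewrite sumEFin lee_fin ltW// (H 'I_N (u \o val) (v \o val))//.
- by move=> i; have [] := uvI i.
- apply/trivIsetP => i j _ _ ij /=.
  have [_ <-] := uvI i; have [_ <-] := uvI j.
  by move/trivIsetP : tI; exact.
- rewrite -lte_fin; apply: le_lt_trans muU.
  rewrite mUI; apply: le_trans (nneseries_lim_ge N _) => //.
  rewrite big_mkord -sumEFin; apply: lee_sum => i _.
  have [uv Ii] := uvI i.
  rewrite [leRHS](_ : _ = (v i - u i)%:E)// Ii.
  rewrite [LHS]lebesgue_measure_itv/= lte_fin.
  by case: ltgtP uv => // -> _; rewrite subrr.
Unshelve. all: by end_near. Qed.

(** The Radon-Nikodym theorem requires a finite measure: here the total mass is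
    [g b - g a], since [g] is constant outside [a, b]. *)
Lemma global_ac_density (a b : R) (g : R -> R) : (a < b)%R ->
  nondecreasing g -> global_ac g -> (forall x, g x = g (clamp a b x)) ->
  exists2 h : R -> R, mu.-integrable setT (EFin \o h) &
    forall x y, (x <= y)%R ->
      (g y - g x)%:E = \int[mu]_(t in `]x, y]) (h t)%:E.
Proof.
move=> ab ndg acg gc.
have rcg : right_continuous g.
  exact/right_continuousW/global_ac_continuous.
pose C : cumulative R R := HB.pack g (isCumulative.Build R _ R g ndg rcg).
pose nu0 : {measure set (measurableTypeR R) -> \bar R} :=
  lebesgue_stieltjes_measure C.
have nu0T : nu0 setT <= (g b - g a)%:E.
  pose F (n : nat) : set (measurableTypeR R) := `](- n%:R)%R, (n%:R)%R]%classic.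
  have FT : \bigcup_n F n = setT.
    rewrite -subTset => x _; exists (Num.bound `|x|%R) => //.
    have := archi_boundP (normr_ge0 x); rewrite ltr_norml => /andP[Nx xN].
    by rewrite /F/= in_itv/= Nx ltW.
  have : nu0 (F n) @[n --> \oo] --> nu0 (\bigcup_n F n).
    apply: nondecreasing_cvg_mu => //.
    - by move=> n; exact: measurable_itv.
    - by rewrite FT; exact: measurableT.
    - move=> m n mn; apply/subsetPset => x; rewrite /F/= !in_itv/= => /andP[mx xm].
      have : (m%:R <= n%:R :> R)%R by rewrite ler_nat.
      by move=> mn'; apply/andP; split; lra.
  rewrite FT => cvF; rewrite -(cvg_lim _ cvF)//; apply: lime_le.
    exact: cvgP cvF.
  near=> n.
  have Nnn : (- n%:R <= n%:R :> R)%R by rewrite (@le_trans _ _ 0%R)// lerNl oppr0.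
  rewrite [leLHS](stieltjes_itvoc C Nnn) lee_fin /=.
  rewrite (gc (n%:R)%R) (gc (- n%:R)%R) lerB// ndg//.
    by have /andP[] := clamp_bound (n%:R)%R (ltW ab).
  by have /andP[] := clamp_bound (- n%:R)%R (ltW ab).
have nu0fin : fin_num_fun nu0.
  move=> A mA; rewrite ge0_fin_numE//.
  apply: (@le_lt_trans _ _ (nu0 setT)); first by apply: le_measure; rewrite ?inE.
  by rewrite (le_lt_trans nu0T)// ltry.
pose nu : {finite_measure set (measurableTypeR R) -> \bar R} :=
  HB.pack (Measure.sort nu0)
    (@Measure_isFinite.Build _ _ _ (Measure.sort nu0) nu0fin).
have numu : charge_of_finite_measure nu `<< mu := stieltjes_dominated (g := C) acg.
pose h := Radon_Nikodym (charge_of_finite_measure nu) mu.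
have hfin x : h x \is a fin_num by exact: Radon_Nikodym_fin_num.
have hE : EFin \o (fine \o h) = h by apply/funext => x /=; rewrite fineK.
exists (fine \o h).
  by rewrite hE; exact: Radon_Nikodym_integrable.
move=> x y xy; rewrite -(stieltjes_itvoc C xy).
transitivity (\int[mu]_(t in `]x, y]) h t).
  by rewrite -Radon_Nikodym_integral.
by apply: eq_integral => t _; rewrite /= fineK.
Unshelve. all: by end_near. Qed.

End absolutely_continuous_stieltjes_measure.

(** * Increments bounded by integrals of the derivative *)

Section fundamental_theorem_inequality.
Context {R : realType}.
Local Notation mu := (@lebesgue_measure R).
Local Open Scope ereal_scope.

Lemma abs_cont_density (a b : R) (f : R -> R) : (a < b)%R -> abs_cont a b f ->
  exists2 h : R -> R, mu.-integrable setT (EFin \o h) &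
    forall x y, (a <= x)%R -> (x <= y)%R -> (y <= b)%R ->
      (f y - f x)%:E = \int[mu]_(t in `]x, y]) (h t)%:E.
Proof.
move=> ab /(abs_cont_decomposition ab)[V [W [[ndV acV Vc] [ndW acW Wc] fVW]]].
have [hV iV VE] := global_ac_density ab ndV acV Vc.
have [hW iW WE] := global_ac_density ab ndW acW Wc.
exists (fun t => hV t - hW t)%R.
  by have := integrableB measurableT iV iW.
move=> x y ax xy yb.
have cx : clamp a b x = x by apply: clampE; rewrite ax (le_trans xy).
have cy : clamp a b y = y by apply: clampE; rewrite yb (le_trans ax).
rewrite -{1}cy -{1}cx !fVW.
under eq_integral do rewrite EFinB.
rewrite integralB//; [|exact: integrableS iV|exact: integrableS iW].
rewrite -VE// -WE// -EFinB; congr EFin; ring.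
Qed.

(** Near a point of the open interval, [f] differs by a constant from the
    indefinite integral of [h], whose derivative is [h] almost everywhere. *)
Lemma abs_cont_derive1 (a b : R) (f h : R -> R) : (a < b)%R ->
  mu.-integrable setT (EFin \o h) ->
  (forall x y, (a <= x)%R -> (x <= y)%R -> (y <= b)%R ->
      (f y - f x)%:E = \int[mu]_(t in `]x, y]) (h t)%:E) ->
  {ae mu, forall x, x \in `]a, b[ -> derive1 f x = h x}.
Proof.
move=> ab ih fE.
pose F x := (\int[mu]_(t in `]a, x]) h t)%R.
have loch : locally_integrable [set: R] h.
  have : locally_integrable [set: R] (h \_ setT) by exact: integrable_locally.
  by rewrite patch_setT.
have ihy y : mu.-integrable [set` Interval (BRight a) (BRight y)] (EFin \o h).
  by apply: integrableS ih.
have := FTC1 ihy loch.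
apply: filterS; first exact: (ae_filter_ringOfSetsType mu).
move=> x /= H; rewrite in_itv/= => /andP[ax xb].
have {}H : derivable F x 1 /\ derive1 F x = h x by exact: H.
have nf : {near x, f =1 (F \+ cst (f a))%R}.
  have : x \in `]a, b[ by rewrite in_itv/= ax.
  move=> /(near_in_itvoo); apply: filterS => y; rewrite in_itv/= => /andP[ay yb].
  rewrite /F /Rintegral/= -(fE a y)//= ?ltW//.
  by rewrite subrK.
rewrite -H.2 !derive1E (near_eq_derive _ nf)//.
by rewrite deriveD// ?derive_cst ?addr0//; exact: H.1.
Qed.

(** This is an equality between integrals of [`|h|] and [`|derive1 f|] preceded
    by the triangle inequality; the end point [b] is removed because
    [derive1 f b] may depend on the values of [f] outside [a, b]. *)
Lemma abs_cont_increment_le (a b : R) (f : R -> R) : (a < b)%R ->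
  abs_cont a b f -> measurable_fun `[a, b] (derive1 f) ->
  forall x y, (a <= x)%R -> (x <= y)%R -> (y <= b)%R ->
  `|f y - f x|%:E <= \int[mu]_(t in `]x, y]) `|derive1 f t|%:E.
Proof.
move=> ab acf mf' x y ax xy yb.
have [h ih fE] := abs_cont_density ab acf.
have aeh := abs_cont_derive1 ab ih fE.
have ih' : mu.-integrable `]x, y] (EFin \o h) by exact: integrableS ih.
have mh : measurable_fun `]x, y] h.
  by move/integrableP : ih' => [/measurable_EFinP].
have mf'xy : measurable_fun `]x, y] (derive1 f).
  apply: measurable_funS mf' => //= t; rewrite /= !in_itv/= => /andP[xt ty].
  by rewrite (le_trans ax (ltW xt)) (le_trans ty yb).
rewrite -abse_EFin (fE x y ax xy yb).
apply: le_trans (le_abse_integral _ _ _) _ => //.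
  by move/integrableP : ih' => [].
rewrite le_eqVlt; apply/orP; left; apply/eqP; apply: ae_eq_integral => //=.
- by apply/measurable_EFinP; exact: measurableT_comp.
- by apply/measurable_EFinP; exact: measurableT_comp.
have nb : {ae mu, forall t, t != b}.
  exists [set b]; split => //; first exact: lebesgue_measure_set1.
  by move=> t /=; case: eqVneq => // ->.
move: nb aeh; apply: filterS2; first exact: (ae_filter_ringOfSetsType mu).
move=> t tb H /=; rewrite in_itv/= => /andP[xt ty].
by rewrite H// in_itv/= (le_lt_trans ax xt) lt_neqAle tb (le_trans ty yb).
Qed.

Lemma abs_cont_increment_window (a b : R) (f : R -> R) (h x u : R) :
  (a < b)%R -> abs_cont a b f -> measurable_fun `[a, b] (derive1 f) ->
  (a <= x <= b)%R -> (a <= u <= b)%R -> (`|u - x| <= h)%R ->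
  `|f u - f x|%:E <= \int[mu]_(t in `[(x - h)%R, (x + h)%R])
    (((fun t => `|derive1 f t|%R) \_ `[a, b]) t)%:E.
Proof.
move=> ab acf mf' /andP[ax xb] /andP[au ub]; rewrite ler_norml => /andP[hux uxh].
set g := _ \_ _.
have g0 t : (0 <= g t)%R by rewrite /g patchE; case: ifP.
have mg : measurable_fun setT g.
  by apply/(measurable_restrictT _ _).1 => //; exact: measurableT_comp.
have sub y z : (a <= y)%R -> (y <= z)%R -> (z <= b)%R ->
    (x - h <= y)%R -> (z <= x + h)%R ->
    `|f z - f y|%:E <= \int[mu]_(t in `[(x - h)%R, (x + h)%R]) (g t)%:E.
  move=> ay yz zb xhy zxh.
  apply: le_trans (abs_cont_increment_le ab acf mf' ay yz zb) _.
  apply: (@le_trans _ _ (\int[mu]_(t in `]y, z]) (g t)%:E)).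
    rewrite le_eqVlt; apply/orP; left; apply/eqP; apply: eq_integral => t.
    rewrite inE/= in_itv/= => /andP[yt tz]; rewrite /g patchE ifT// inE/= in_itv/=.
    by rewrite (le_trans ay (ltW yt)) (le_trans tz zb).
  apply: ge0_subset_integral => //.
  - by apply/measurable_EFinP; exact: measurable_funTS.
  - by move=> t _; rewrite lee_fin.
  - by move=> t; rewrite /= !in_itv/=; lra.
have [ux|xu] := leP u x; first by rewrite distrC; apply: sub => //; lra.
by apply: sub => //; lra.
Qed.

End fundamental_theorem_inequality.

(** * Convex functions *)

Section convex_functions.
Context {R : realType}.
Implicit Types phi : R -> R.

Lemma convex_chord phi (x y z : R) :
  convex_function (`[0, +oo[ : set R^o) phi -> 0 <= x -> x < y -> y < z ->
  (z - x) * phi y <= (z - y) * phi x + (y - x) * phi z.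
Proof.
move=> cphi x0 xy yz; have xz := lt_trans xy yz.
have zx0 : 0 < z - x by rewrite subr_gt0.
have s0 : 0 <= (z - y) / (z - x) by rewrite divr_ge0 ?subr_ge0 ?ltW.
have s1 : (z - y) / (z - x) <= 1 by rewrite ler_pdivrMr// mul1r; lra.
have /(_ x z) := cphi (Itv01 s0 s1).
rewrite !inE/= !in_itv/= !andbT x0 (le_trans x0 (ltW xz)) => /(_ isT isT).
rewrite !convRE/= /unstable.onem.
rewrite [X in phi X <= _](_ : _ = y); last first.
  transitivity ((z - y) / (z - x) * x + (1 - (z - y) / (z - x)) * z) => //.
  by field; rewrite gt_eqF.
have -> : (z - y) / (z - x) * phi x + (1 - (z - y) / (z - x)) * phi z =
    ((z - y) * phi x + (y - x) * phi z) / (z - x).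
  by field; rewrite gt_eqF.
by rewrite ler_pdivlMr// mulrC.
Qed.

(** The slope is the infimum of the slopes of the chords to the right of [m]: it
    is at least every slope to the left by convexity, and nonnegative by
    monotonicity.  At [m = 0] there are no chords to the left, hence the choice
    of the right-hand slopes. *)
Lemma convex_supporting_line phi m : convex_phi_function phi -> 0 <= m ->
  exists2 c, 0 <= c & forall t, 0 <= t -> phi m + c * (t - m) <= phi t.
Proof.
move=> [pphi cphi] m0; have ndphi := phi_nondecreasing pphi.
pose S := [set (phi t - phi m) / (t - m) | t in [set t | m < t]].
have Sn0 : S !=set0.
  by exists ((phi (m + 1) - phi m) / (m + 1 - m)), (m + 1) => //=; rewrite ltrDl.
have lbS s : 0 <= s -> s < m -> lbound S ((phi m - phi s) / (m - s)).
  move=> s0 sm _ [t /= mt <-].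
  rewrite ler_pdivrMr ?subr_gt0// mulrAC ler_pdivlMr ?subr_gt0//.
  by have := convex_chord cphi s0 sm mt; lra.
have lb0 : lbound S 0.
  move=> _ [t /= mt <-]; rewrite divr_ge0 ?subr_ge0 ?(ltW mt)//.
  apply: ndphi; rewrite ?in_itv/= ?andbT ?(ltW mt)//.
  exact: le_trans (ltW mt).
exists (inf S); first exact: lb_le_inf.
move=> t t0; have [tm|mt|->] := ltgtP t m.
- have : (phi m - phi t) / (m - t) <= inf S by apply: lb_le_inf => //; exact: lbS.
  by rewrite ler_pdivrMr ?subr_gt0//; lra.
- have : inf S <= (phi t - phi m) / (t - m).
    by apply: ge_inf; [exists 0|exists t].
  by rewrite ler_pdivlMr ?subr_gt0//; lra.
- by rewrite subrr mulr0 addr0.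
Qed.

Lemma phi_function_ge0 phi u : phi_function phi -> 0 <= u -> 0 <= phi u.
Proof.
move=> pphi u0; rewrite -(phi0 pphi).
by apply: (phi_nondecreasing pphi); rewrite ?in_itv/= ?andbT.
Qed.

Lemma measurable_phi_comp phi (g : R -> R) : phi_function phi ->
  measurable_fun setT g -> (forall t, 0 <= g t) ->
  measurable_fun setT (fun t => phi (g t)).
Proof.
move=> pphi mg g0.
have -> : (fun t => phi (g t)) = (fun u => phi (Num.max 0 u)) \o g.
  by apply/funext => t /=; rewrite max_r.
apply: measurableT_comp => //; apply: nondecreasing_measurable => //.
move=> x y xy; apply: (phi_nondecreasing pphi); rewrite ?in_itv/= ?le_max ?lexx//.
by rewrite /Num.max; do ! case: ifP; lra.
Qed.

End convex_functions.

(** * Positivity of the density and the pointwise error *)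

Section density_of_sigmoidal.
Context {R : realType}.
Implicit Types (s : R -> R) (x y t : R).

(** If [s x = s y], concavity keeps [s] below that value beyond [y], so that the
    limit 1 would be at most [s x <= s 1 < 1]. *)
Lemma sigmoidal_lt s x y : sigmoidal s -> 0 <= x -> x < y -> x <= 1 -> s x < s y.
Proof.
move=> hs x0 xy x1; rewrite ltNge; apply/negP => yx.
suff : (1 : R) <= s 1 by rewrite leNgt (sigmoidal_lt1 hs).
have cv1 := sigmoidal_pinfty hs.
rewrite -[leLHS](cvg_lim _ cv1)//; apply: limr_le; first exact: cvgP cv1.
near=> z.
have yz : y < z by near: z; apply: nbhs_pinfty_gt; exact: num_real.
have := convex_chord (sigmoidal_concave hs) x0 xy yz.
have sx1 : s x <= s 1 by exact: sigmoidal_nondecreasing.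
have : s x <= s y by apply: sigmoidal_nondecreasing => //; exact: ltW.
move=> xley chord; apply: le_trans sx1.
have sxy : s x = s y by apply/eqP; rewrite eq_le xley yx.
move: chord; rewrite -sxy => chord.
have yx0 : 0 < y - x by rewrite subr_gt0.
by rewrite -(ler_pM2l yx0); lra.
Unshelve. all: by end_near. Qed.

Lemma density_even s t : sigmoidal s -> density s (- t) = density s t.
Proof.
move=> hs; rewrite /density.
have := sigmoidal_odd hs (t - 1); have := sigmoidal_odd hs (t + 1).
by rewrite [- (t - 1)](_ : _ = - t + 1) ?opprD//; lra.
Qed.

Lemma density_ge0 s t : sigmoidal s -> 0 <= density s t.
Proof.
move=> hs; rewrite /density mulr_ge0// ?invr_ge0// subr_ge0.
by apply: (sigmoidal_nondecreasing hs); lra.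
Qed.

Lemma density_gt0 s t : sigmoidal s -> `|t| <= 2 -> 0 < density s t.
Proof.
move=> hs; have -> : density s t = density s `|t|.
  by case: (ger0P t) => // _; rewrite density_even.
move: (`|t|) (normr_ge0 t) => {}t t0 t2.
rewrite /density mulr_gt0// ?invr_gt0// subr_gt0.
have [t1|t1] := leP 1 t; first by apply: (sigmoidal_lt hs); lra.
apply: (@le_lt_trans _ _ (s 0)).
  by apply: (sigmoidal_nondecreasing hs); lra.
apply: (@lt_le_trans _ _ (s 1)); first by apply: (sigmoidal_lt hs); lra.
by apply: (sigmoidal_nondecreasing hs); lra.
Qed.

End density_of_sigmoidal.

Section pointwise_estimate.
Context {R : realType}.
Local Notation mu := (@lebesgue_measure R).

(** The cell of [n * x] is moved into the admissible range if necessary.  The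
    last admissible index is [floor (n b) - 1], up to 2 below [n * b], which is
    why positivity of the density is needed on all of [-2, 2]. *)
Lemma index_near (a b x : R) (n : nat) :
  Num.ceil (n%:R * a) <= Num.floor (n%:R * b) - 1 -> a <= x <= b ->
  exists2 k : int,
    k \in int_range (Num.ceil (n%:R * a)) (Num.floor (n%:R * b) - 1) &
    `|n%:R * x - k%:~R| <= 2.
Proof.
set N : R := n%:R; set p := Num.ceil _; set q := Num.floor _ - 1.
move=> pq /andP[ax xb].
have N0 : 0 <= N by exact: ler0n.
have Nax : N * a <= N * x by exact: ler_wpM2l.
have Nxb : N * x <= N * b by exact: ler_wpM2l.
have pE : p%:~R < N * a + 1 :> R by have := gt_pred_ceil (N * a); rewrite intrB; lra.
have pE' : N * a <= p%:~R := ceil_ge _.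
have qE : N * b < q%:~R + 2 :> R.
  by have := floorD1_gt (N * b); rewrite /q intrB intrD; lra.
have fl := floor_le (N * x).
have fl' := floorD1_gt (N * x).
rewrite intrD in fl'.
have [Nxp|pNx] := ltP (N * x) p%:~R.
  exists p; first by rewrite mem_int_range lexx.
  by rewrite ler_norml; lra.
have [qNx|Nxq] := ltP q%:~R (N * x).
  exists q; first by rewrite mem_int_range lexx andbT.
  by rewrite ler_norml; lra.
exists (Num.floor (N * x)).
  rewrite mem_int_range floor_ge_int pNx/= -(ler_int R).
  by rewrite (le_trans fl).
by rewrite ler_norml; lra.
Qed.

Lemma mean_value_le (G : R -> R) (l w y M : R) : 0 < w -> continuous G ->
  (forall u, l <= u <= l + w -> `|G u - y| <= M) ->
  `|w^-1 * (\int[mu]_(u in `[l, l + w]) G u) - y| <= M.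
Proof.
move=> w0 cG GM; set J := `[l, l + w]%classic.
have muJ : mu J = w%:E.
  by rewrite /J lebesgue_measure_itv/= lte_fin ltrDl w0 -EFinB addrAC subrr add0r.
have iG : mu.-integrable J (EFin \o G).
  apply: continuous_compact_integrable; first exact: segment_compact.
  by apply: continuous_subspaceT.
have ic c : mu.-integrable J (EFin \o (fun=> c)).
  apply: continuous_compact_integrable; first exact: segment_compact.
  by apply: continuous_subspaceT => ?; exact: cvg_cst.
have intc c : \int[mu]_(u in J) c = c * w.
  transitivity (c * fine (mu J)); last by rewrite muJ.
  by apply: Rintegral_cst; exact: measurable_itv.
have lo : (y - M) * w <= \int[mu]_(u in J) G u.
  rewrite -intc; apply: le_Rintegral => //; first exact: measurable_itv.
  move=> u; rewrite /J/= in_itv/= => /GM.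
  by rewrite ler_norml; lra.
have hi : \int[mu]_(u in J) G u <= (y + M) * w.
  rewrite -intc; apply: le_Rintegral => //; first exact: measurable_itv.
  move=> u; rewrite /J/= in_itv/= => /GM.
  by rewrite ler_norml; lra.
rewrite ler_norml; apply/andP; split.
  by rewrite lerBrDl addrC mulrC ler_pdivlMr// addrC.
by rewrite lerBlDl mulrC ler_pdivrMr.
Qed.

(** For an index [k] with nonzero weight, every point of its cell is at distance
    at most [n^-1] from [k / n], itself at distance at most [U / n] from [x]. *)
Lemma Kantorovich_error_le (a b : R) (s f : R -> R) (n : nat) (U x M : R) :
  a < b -> sigmoidal s -> 0 < U -> supp (density s) `<=` `[- U, U] ->
  abs_cont a b f ->
  Num.ceil (n%:R * a) <= Num.floor (n%:R * b) - 1 -> a <= x <= b ->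
  (forall u, a <= u <= b -> `|u - x| <= (1 + U) / n%:R -> `|f u - f x| <= M) ->
  `|Kantorovich a b s f n x - f x| <= M.
Proof.
move=> ab hs U0 suppU acf pq /[dup] xab /andP[ax xb] fM.
set N : R := n%:R in pq fM *.
(* n = 0 would make the range of indices empty: ceil 0 > floor 0 - 1 *)
have N0 : 0 < N.
  rewrite lt_neqAle ler0n andbT eq_sym /N pnatr_eq0.
  apply: contraTneq pq => n0.
  by rewrite /N n0 !mul0r ceil0 floor0.
set p := Num.ceil _ in pq; set q := Num.floor _ - 1 in pq.
pose G := f \o clamp a b.
have cG : continuous G by exact/global_ac_continuous/abs_cont_clamp.
pose r := int_range p q; pose d k := density s (N * x - k%:~R).
pose A k := N * (\int[mu]_(u in `[k%:~R / N, (k + 1)%:~R / N]) f u).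
have d0 k : 0 <= d k by exact: density_ge0.
have S0 : 0 < \sum_(k <- r) d k.
  have [k kr Nxk] := index_near pq xab.
  rewrite (big_rem k kr)/= ltr_pwDl// ?density_gt0//.
  by apply: sumr_ge0.
have AM k : k \in r -> `|A k - f x| * d k <= M * d k.
  move=> kr; have [dk0|dk0] := eqVneq (d k) 0; first by rewrite dk0 !mulr0.
  have : `[- U, U]%classic (N * x - k%:~R).
    by apply: suppU; apply: subset_closure.
  rewrite /= in_itv/= => /andP[Uk kU].
  rewrite ler_wpM2r//.
  move: kr; rewrite mem_int_range => /andP[pk kq].
  have ak : N * a <= k%:~R by rewrite (le_trans (ceil_ge _))// ler_int.
  have kb : k%:~R + 1 <= N * b.
    rewrite (le_trans _ (floor_le _))//.
    by move: kq; rewrite /q -(ler_int R) intrB; lra.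
  have kE : (k + 1)%:~R / N = k%:~R / N + N^-1 by rewrite intrD mulrDl mul1r.
  have sub u : k%:~R / N <= u <= k%:~R / N + N^-1 ->
      a <= u <= b /\ `|u - x| <= (1 + U) / N.
    rewrite -kE intrD => /andP[]; rewrite ler_pdivrMr// ler_pdivlMr// => ku uk.
    split.
      by rewrite -[a <= u](ler_pM2l N0) -[u <= b](ler_pM2l N0); lra.
    by rewrite ler_pdivlMr// -[X in _ * X](gtr0_norm N0) -normrM ler_norml; lra.
  rewrite /A (_ : \int[mu]_(u in _) f u =
      \int[mu]_(u in `[k%:~R / N, k%:~R / N + N^-1]) G u); last first.
    rewrite kE; apply: eq_Rintegral => u; rewrite inE/= in_itv/= => /sub[uab _].
    by rewrite /G/= clampE.
  rewrite -[X in X * _]invrK; apply: mean_value_le => //; first by rewrite invr_gt0.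
  by move=> u /sub[uab ux]; rewrite /G/= clampE//; exact: fM.
have -> : Kantorovich a b s f n x - f x =
    (\sum_(k <- r) (A k - f x) * d k) / (\sum_(k <- r) d k).
  apply: (@mulIf _ (\sum_(k <- r) d k)); first by rewrite gt_eqF.
  rewrite divfK ?gt_eqF// mulrBl /Kantorovich divfK ?gt_eqF//.
  rewrite mulr_sumr -sumrB; apply: eq_bigr => k _.
  by rewrite mulrBl.
rewrite normrM normfV (gtr0_norm S0) ler_pdivrMr//.
rewrite (le_trans (ler_norm_sum _ _ _))// mulr_sumr.
rewrite big_seq [leRHS]big_seq; apply: ler_sum => k kr.
by rewrite normrM (ger0_norm (d0 k)) AM.
Qed.

End pointwise_estimate.

(** * Moving windows and Jensen's inequality *)

Section moving_windows.
Context {R : realType}.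
Local Notation mu := (@lebesgue_measure R).
Local Open Scope ereal_scope.

(** The integral of a nonnegative function is a supremum over simple functions
    below it, hence monotone even on nonmeasurable functions.  This dispenses
    with proving that Kantorovich operators and window integrals are measurable
    in [x]. *)
Lemma ge0_le_integral_nonmeas d (T : measurableType d)
    (m : {measure set T -> \bar R}) (D : set T) (f1 f2 : T -> \bar R) :
  (forall x, D x -> 0 <= f1 x) -> (forall x, D x -> f1 x <= f2 x) ->
  \int[m]_(x in D) f1 x <= \int[m]_(x in D) f2 x.
Proof.
move=> f10 f12.
have f20 x : D x -> 0 <= f2 x by move=> Dx; rewrite (le_trans (f10 x Dx)) ?f12.
rewrite !ge0_integralE//; apply: le_ereal_sup => _ [h hf1 <-]; exists h => // x.
apply: le_trans (hf1 x) _; rewrite !patchE; case: ifPn => // /set_mem.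
exact: f12.
Qed.

Lemma lebesgue_window (x h : R) : (0 < h)%R ->
  mu `[(x - h)%R, (x + h)%R] = (2 * h)%:E.
Proof.
move=> h0; rewrite lebesgue_measure_itv/= lte_fin.
by rewrite ifT ?ltrBlDr; [rewrite -EFinB; congr EFin; ring|lra].
Qed.

(** By Tonelli's theorem: [t] lies in the window of [x] if and only if [x] lies in
    the window of [t], so [psi t] is counted with weight [2 * h]. *)
Lemma integral_moving_window (psi : R -> R) (h : R) : (0 < h)%R ->
  measurable_fun setT psi -> (forall t, (0 <= psi t)%R) ->
  \int[mu]_x \int[mu]_(t in `[(x - h)%R, (x + h)%R]) (psi t)%:E =
  (2 * h)%:E * \int[mu]_t (psi t)%:E.
Proof.
move=> h0 mpsi psi0.
pose band : set (measurableTypeR R * measurableTypeR R) :=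
  (fun z => z.1 - z.2)%R @^-1` `[(- h)%R, h].
have mband : measurable band.
  rewrite -[band]setTI; apply: measurable_funB => //; exact: measurable_itv.
pose F (z : measurableTypeR R * measurableTypeR R) : \bar R :=
  (psi z.2 * \1_band z)%:E.
have F0 z : 0 <= F z by rewrite lee_fin mulr_ge0.
have mF : measurable_fun setT F.
  apply/measurable_EFinP; apply: measurable_funM.
    exact: (measurableT_comp mpsi).
  exact: measurable_indic.
transitivity (\int[mu]_x \int[mu]_t F (x, t)).
  apply: eq_integral => x _; rewrite integral_mkcond; apply: eq_integral => t _.
  rewrite /F /band patchE indicE /=.
  have -> : (t \in `[(x - h)%R, (x + h)%R]%classic) = ((x, t) \in band).
    by apply/idP/idP; rewrite !inE /band/= !in_itv/=; lra.
  by case: ifPn => _; rewrite ?mulr1 ?mulr0.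
rewrite fubini_tonelli//.
rewrite -ge0_integralZl//; last 3 first.
- by apply/measurable_EFinP.
- by move=> t _; rewrite lee_fin.
- by rewrite lee_fin mulr_ge0// ltW.
apply: eq_integral => t _.
transitivity (\int[mu]_x
    ((psi t)%:E * (\1_(`[(t - h)%R, (t + h)%R]%classic : set R) x)%:E)).
  apply: eq_integral => x _; rewrite /F EFinM; congr (_ * _%:E).
  rewrite !indicE; congr (_%:R); apply/congr1.
  by apply/idP/idP; rewrite !inE /band/= !in_itv/=; lra.
rewrite ge0_integralZl_EFin//.
- rewrite muleC; congr (_ * _).
  rewrite -(lebesgue_window t h0) -[in RHS](setIT `[_, _]%classic) -integral_indic//.
- apply/measurable_EFinP; apply: measurable_indic; exact: measurable_itv.
Qed.

(** Jensen's inequality for the mean over the window, from the supporting line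
    of [phi] at [A] integrated over the window.  Monotonicity of [phi] lets [A]
    be any lower bound of the mean of [2 * h * g].  The term [c * A] is moved to
    the right so that both sides are nonnegative and their integrals split in
    the extended reals. *)
Lemma jensen_window (phi g : R -> R) (x h A : R) :
  convex_phi_function phi -> (0 < h)%R ->
  measurable_fun setT g -> (forall t, (0 <= g t)%R) -> (0 <= A)%R ->
  A%:E <= \int[mu]_(t in `[(x - h)%R, (x + h)%R]) (g t)%:E ->
  (phi A)%:E <=
    \int[mu]_(t in `[(x - h)%R, (x + h)%R]) (phi (2 * h * g t) / (2 * h))%:E.
Proof.
move=> cphi h0 mg g0 A0 Ag; have [pphi _] := cphi.
have h20 : (0 < 2 * h)%R by rewrite mulr_gt0.
have [c c0 cP] := convex_supporting_line cphi A0.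
set D := `[_, _]%classic in Ag *.
have mD : measurable D by exact: measurable_itv.
pose X := \int[mu]_(t in D) (phi (2 * h * g t) / (2 * h))%:E.
have mhg : measurable_fun setT (fun t => 2 * h * g t)%R.
  by apply: measurable_funM => //.
have hg0 t : (0 <= 2 * h * g t)%R by rewrite mulr_ge0// ltW.
have mphi : measurable_fun setT (fun t => phi (2 * h * g t))%R.
  exact: measurable_phi_comp.
have phi0' t : (0 <= phi (2 * h * g t))%R by exact: phi_function_ge0.
(* the supporting line at A, taken at 2 * h * g t and divided by 2 * h *)
have key : \int[mu]_(t in D) (phi A / (2 * h) + c * g t)%:E <=
    \int[mu]_(t in D) (phi (2 * h * g t) / (2 * h) + c * A / (2 * h))%:E.
  apply: ge0_le_integral_nonmeas => t _; rewrite lee_fin.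
    apply: addr_ge0; last exact: mulr_ge0.
    by rewrite divr_ge0 ?(ltW h20)// phi_function_ge0.
  rewrite -(ler_pM2l h20) !mulrDr.
  have -> : (2 * h * (phi A / (2 * h)) = phi A)%R by field; rewrite gt_eqF.
  have -> : (2 * h * (phi (2 * h * g t) / (2 * h)) = phi (2 * h * g t))%R.
    by field; rewrite gt_eqF.
  have -> : (2 * h * (c * A / (2 * h)) = c * A)%R by field; rewrite gt_eqF.
  by have := cP _ (hg0 t); lra.
have intc r : \int[mu]_(t in D) (r / (2 * h))%:E = r%:E.
  transitivity ((r / (2 * h))%:E * mu D); first exact: integral_cst.
  rewrite (_ : mu D = (2 * h)%:E); last exact: lebesgue_window.
  by rewrite -EFinM; congr EFin; field; rewrite gt_eqF.
have mg' : measurable_fun D g by exact: measurable_funTS.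
have mphi' : measurable_fun D (fun t => phi (2 * h * g t))%R.
  exact: measurable_funTS.
have phiA0 : (0 <= phi A)%R by exact: phi_function_ge0.
have lhsE : \int[mu]_(t in D) (phi A / (2 * h) + c * g t)%:E =
    (phi A)%:E + c%:E * \int[mu]_(t in D) (g t)%:E.
  under eq_integral do rewrite EFinD.
  rewrite ge0_integralD//; last 3 first.
  - by move=> t _; rewrite lee_fin divr_ge0// ltW.
  - by move=> t _; rewrite lee_fin mulr_ge0.
  - by apply/measurable_EFinP; apply: measurable_funM.
  rewrite intc; congr (_ + _).
  under eq_integral do rewrite EFinM.
  rewrite ge0_integralZl_EFin//.
  - by move=> t _; rewrite lee_fin.
  - by apply/measurable_EFinP.
have rhsE : \int[mu]_(t in D) (phi (2 * h * g t) / (2 * h) + c * A / (2 * h))%:E =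
    X + (c * A)%:E.
  under eq_integral do rewrite EFinD.
  rewrite ge0_integralD//; last 3 first.
  - by move=> t _; rewrite lee_fin divr_ge0// ltW.
  - by apply/measurable_EFinP; apply: measurable_funM.
  - by move=> t _; rewrite lee_fin divr_ge0 ?mulr_ge0 ?(ltW h0).
  by rewrite intc.
move: key; rewrite lhsE rhsE => key.
have X0 : 0 <= X by apply: integral_ge0 => t _; rewrite lee_fin divr_ge0// ltW.
have : (phi A)%:E + c%:E * A%:E <= X + (c * A)%:E.
  by apply: le_trans key; rewrite leeD2l// lee_wpmul2l.
rewrite -/X; clear rhsE key; clearbody X.
case: X X0 => [X _| _ _|//]; last by rewrite leey.
by rewrite -!EFinM -!EFinD !lee_fin; lra.
Qed.

End moving_windows.


(** * The modular estimate *)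

Theorem theorem4p4 (R : realType) (a b : R) (ab : a < b)
    (phi : R -> R) (hphi : convex_phi_function phi)
    (sigma : R -> R) (hsigma : sigmoidal sigma)
    (Upsilon : R) (Upsilon_gt0 : 0 < Upsilon)
    (hcompact : compact (supp (density sigma)))
    (hsupp : supp (density sigma) `<=` `[- Upsilon, Upsilon])
    (f : R -> R) (hf : Sobolev_Orlicz phi a b f) :
  exists2 lambda : R, 0 < lambda &
    forall n : nat,
      Num.ceil (n%:R * a) <= Num.floor (n%:R * b) - 1 ->
      (modular phi a b
         (fun x => (lambda * (Kantorovich a b sigma f n x - f x))%R)
       <= modular phi a b
         (fun x => (2 * lambda * (1 + Upsilon) / n%:R * derive1 f x)%R))%E.
Proof.
have [pphi _] := hphi; have [acf [mf' _]] := hf.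
exists 1 => // n pq.
have n0 : 0 < n%:R :> R.
  rewrite lt_neqAle ler0n andbT eq_sym pnatr_eq0.
  by apply: contraTneq pq => ->; rewrite !mul0r ceil0 floor0.
pose h := (1 + Upsilon) / n%:R.
have h0 : 0 < h by rewrite divr_gt0//; lra.
have h20 : 0 < 2 * h by rewrite mulr_gt0.
pose g := (fun t => `|derive1 f t|) \_ `[a, b].
have g0 t : 0 <= g t by rewrite /g patchE; case: ifP.
have mg : measurable_fun setT g.
  by apply/(measurable_restrictT _ _).1 => //; exact: measurableT_comp.
pose psi t := phi (2 * h * g t) / (2 * h).
have mphi : measurable_fun setT (fun t => phi (2 * h * g t)).
  apply: measurable_phi_comp => //; first exact: measurable_funM.
  by move=> t; rewrite mulr_ge0// ltW.
have phig0 t : 0 <= phi (2 * h * g t).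
  by apply: phi_function_ge0 => //; rewrite mulr_ge0// ltW.
have mpsi : measurable_fun setT psi by exact: measurable_funM.
have psi0 t : 0 <= psi t by rewrite divr_ge0// ltW.
have pt x : a <= x <= b -> ((phi `|Kantorovich a b sigma f n x - f x|)%:E <=
    \int[lebesgue_measure]_(t in `[(x - h)%R, (x + h)%R]) (psi t)%:E)%E.
  move=> xab; apply: jensen_window => //.
  have inc u := @abs_cont_increment_window _ a b f h x u ab acf mf' xab.
  move: inc; rewrite -/g; set I := (\int[_]_(t in _) _)%E => inc.
  have I0 : (0 <= I)%E by apply: integral_ge0 => t _; rewrite lee_fin.
  clearbody I; case: I I0 inc => [M _ inc|_ _|//]; last by rewrite leey.
  by rewrite lee_fin; apply: (Kantorovich_error_le (U := Upsilon) ab hsigma).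
rewrite /modular.
apply: (@le_trans _ _ (\int[lebesgue_measure]_(x in `[a, b])
    \int[lebesgue_measure]_(t in `[(x - h)%R, (x + h)%R]) (psi t)%:E)%E).
  apply: ge0_le_integral_nonmeas => x; rewrite /= in_itv/= => xab.
    by rewrite lee_fin phi_function_ge0.
  by rewrite mul1r; exact: pt.
have -> : (\int[lebesgue_measure]_(x in `[a, b])
      (phi `|2 * 1 * (1 + Upsilon) / n%:R * derive1 f x|)%:E =
    \int[lebesgue_measure]_t (phi (2 * h * g t))%:E)%E.
  rewrite integral_mkcond; apply: eq_integral => t _; rewrite patchE /g patchE.
  case: ifP => _; last by rewrite mulr0 (phi0 pphi).
  congr (phi _)%:E; rewrite normrM; congr (_ * _).
  by rewrite mulr1 -mulrA gtr0_norm.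
apply: (@le_trans _ _ (\int[lebesgue_measure]_x
    \int[lebesgue_measure]_(t in `[(x - h)%R, (x + h)%R]) (psi t)%:E)%E).
  rewrite integral_mkcond; apply: ge0_le_integral_nonmeas => x _; rewrite patchE.
    by case: ifP => // _; apply: integral_ge0 => t _; rewrite lee_fin.
  by case: ifP => // _; apply: integral_ge0 => t _; rewrite lee_fin.
rewrite integral_moving_window// -ge0_integralZl_EFin ?(ltW h20)//.
- rewrite le_eqVlt; apply/orP; left; apply/eqP; apply: eq_integral => t _.
  by rewrite -EFinM /psi; congr EFin; field; rewrite gt_eqF.
- by move=> t _; rewrite lee_fin.
- exact/measurable_EFinP.
Qed.
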